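(* Let $n_1,n_2,\ldots,n_k\in\mathbb{N}$ (positive integers). Then $$W(H(2n_1,2n_2,\ldots,2n_k))\leq \frac{1}{2}(k+1)\sum_{i=1}^{k}(4n_i-3).$$
   Context: All graphs are finite, undirected, without loops or multiple edges. An interval $t$-coloring of a graph $G$ ($t$ a positive integer) is a proper edge-coloring of $G$ with colors $1,\ldots,t$ such that all colors are used and, for each vertex $v$, the set of colors of the edges incident to $v$ is an interval of integers. $G$ is interval colorable if it has an interval $t$-coloring for some positive integer $t$; then $W(G)$ denotes the maximum such $t$. The Hamming graph $H(m_1,\ldots,m_k)$ is the Cartesian product of complete graphs $K_{m_1}\square K_{m_2}\square\cdots\square K_{m_k}$. (It is known that $H(m_1,\ldots,m_k)$ is interval colorable whenever $m_1\cdots m_k$ is even.) *)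

(* Defs.v *)
From mathcomp Require Import all_boot.
From mathcomp Require Import boolp.
Set Implicit Arguments.
Unset Strict Implicit.
Unset Printing Implicit Defensive.

Record sgraph := SGraph {
  vertex :> finType;
  adj : rel vertex;
  adj_sym : symmetric adj;
  adj_irrefl : irreflexive adj }.

Definition edges (G : sgraph) : {set {set G}} :=
  [set e : {set G} | [exists x, exists y, adj x y && (e == [set x; y])]].

Definition incident (G : sgraph) (v : G) : {set {set G}} :=
  [set e in edges G | v \in e].

Definition proper_edge_coloring (G : sgraph) (c : {set G} -> nat) : Prop :=
  forall e f, e \in edges G -> f \in edges G ->
    e != f -> e :&: f != set0 -> c e <> c f.

Definition nat_interval (S : nat -> Prop) : Prop :=
  forall a b m, S a -> S b -> a <= m <= b -> S m.

(* Only the values of [c] on [edges G] matter. *)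
Definition interval_coloring (G : sgraph) (t : nat) (c : {set G} -> nat) :
    Prop :=
  [/\ proper_edge_coloring c,
      forall e, e \in edges G -> 1 <= c e <= t,
      forall i, 1 <= i <= t -> exists2 e, e \in edges G & c e = i
    & forall v : G, nat_interval (fun i => exists2 e, e \in incident v & c e = i)].

Definition has_interval_coloring (G : sgraph) (t : nat) : Prop :=
  0 < t /\ exists c : {set G} -> nat, interval_coloring t c.

Definition interval_colorable (G : sgraph) : Prop :=
  exists t, has_interval_coloring G t.

(* All [t] colors are used, so [t <= #|edges G|] and the range loses nothing;
   see [maxW_spec].  If [G] is not interval colorable the value is [0]. *)
Definition maxW (G : sgraph) : nat :=
  \max_(t < #|edges G|.+1 | `[< has_interval_coloring G t >]) t.

Lemma has_interval_coloring_le (G : sgraph) t :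
  has_interval_coloring G t -> t <= #|edges G|.
Proof.
case=> _ [c [_ _ used _]].
rewrite -(size_iota 1 t) cardE -(size_map c).
apply: uniq_leq_size (iota_uniq _ _) _ => i.
rewrite mem_iota add1n ltnS => /used[e eE <-].
by apply: map_f; rewrite mem_enum.
Qed.

Lemma maxW_spec (G : sgraph) : interval_colorable G ->
  has_interval_coloring G (maxW G) /\
  forall t, has_interval_coloring G t -> t <= maxW G.
Proof.
case=> t0 Ht0.
have ltE t : has_interval_coloring G t -> t < #|edges G|.+1.
  by move/has_interval_coloring_le.
split=> [|t Ht].
  have P0 : `[< has_interval_coloring G (Ordinal (ltE _ Ht0)) >] by apply/asboolP.
  rewrite /maxW (bigmax_eq_arg _ P0).
  by case: arg_maxnP => // i /asboolP.
by apply: (bigmax_sup (Ordinal (ltE _ Ht))) => //; apply/asboolP.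
Qed.

Section CompleteGraph.
Variable m : nat.
Let K_adj : rel 'I_m := fun x y => x != y.
Fact K_sym : symmetric K_adj. Proof. by move=> x y; rewrite /K_adj eq_sym. Qed.
Fact K_irrefl : irreflexive K_adj. Proof. by move=> x; rewrite /K_adj eqxx. Qed.
Definition complete_graph : sgraph := SGraph K_sym K_irrefl.
End CompleteGraph.

(* k-fold product: the binary product iterated, with vertices presented as
   dependent k-tuples instead of nested pairs. *)
Section CartesianProduct.
Variables (k : nat) (G : 'I_k -> sgraph).
Let V : finType := {dffun forall i : 'I_k, G i}.
Definition cart_adj : rel V := fun u v =>
  [exists i, adj (u i) (v i) && [forall j, (j != i) ==> (u j == v j)]].
Fact cart_sym : symmetric cart_adj.
Proof.
move=> u v; apply: eq_existsb => i; rewrite adj_sym; congr andb.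
by apply: eq_forallb => j; rewrite [u j == _]eq_sym.
Qed.
Fact cart_irrefl : irreflexive cart_adj.
Proof. by move=> u; apply/existsP=> -[i]; rewrite adj_irrefl. Qed.
Definition cart_prod : sgraph := SGraph cart_sym cart_irrefl.
End CartesianProduct.

Definition hamming_graph (k : nat) (m : 'I_k -> nat) : sgraph :=
  cart_prod (fun i => complete_graph (m i)).

(* Main.v *)
Require Import Defs.
From mathcomp Require Import all_boot all_order all_algebra.
From mathcomp Require Import boolp zify ring.
Import Order.TTheory GRing.Theory Num.Theory.
Local Open Scope ring_scope.
Set Implicit Arguments.
Unset Strict Implicit.

(** Take an interval [t]-coloring of a graph of maximum degree at most [D], an
    edge at [u] of color [1] and an edge at [v] of color [t], and walk from [u]
    to [v] choosing the next edge greedily.  The colors at a vertex [w] fill an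
    interval of length at most [D]; so if [w] has [d] neighbors that are one
    step closer to [v], the smallest color on the [d] edges leading to them
    exceeds any other color at [w] by at most [D - d]
    ([small_color_in_incident]).  Following that edge, the color grows by at most
    [D - d] when the distance to [v] is [d], and at [v] itself by less than [D].

    In a Hamming graph with [k] factors, a vertex at distance [d] from [v]
    differs from it in [d] coordinates, and correcting any one of them is a step
    towards [v]: there are [d] closer neighbors.  As the diameter is at most
    [k], the sum of the increments gives [t <= \sum_(0 <= j <= k) (D - j)], with
    [D = \sum_i (m_i - 1)].  For [m_i = 2 n_i] this sum is
    [(k + 1) (D - k / 2)], which is the stated bound. *)

Local Open Scope nat_scope.

(** * Edges at a vertex *)

Lemma edge_adj (G : sgraph) (u w : G) : adj u w -> [set u; w] \in edges G.
Proof.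
by move=> uw; rewrite inE; apply/existsP; exists u; apply/existsP; exists w;
  rewrite uw eqxx.
Qed.

Lemma incident_adj (G : sgraph) (u w : G) :
  adj u w -> [set u; w] \in incident u /\ [set u; w] \in incident w.
Proof. by move=> uw; split; rewrite inE edge_adj //= !inE eqxx ?orbT. Qed.

Lemma incidentP (G : sgraph) (u : G) (e : {set G}) :
  e \in incident u -> exists2 w, adj u w & e = [set u; w].
Proof.
rewrite inE => /andP[]; rewrite inE => /existsP[x /existsP[y /andP[xy /eqP->]]].
rewrite !inE => /orP[]/eqP->; first by exists y.
by exists x; rewrite ?[adj y x]adj_sym // setUC.
Qed.

Lemma edge_incident (G : sgraph) (e : {set G}) :
  e \in edges G -> exists u, e \in incident u.
Proof.
move=> eE; have := eE; rewrite inE => /existsP[x /existsP[y /andP[_ /eqP De]]].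
by exists x; rewrite inE eE /= De !inE eqxx.
Qed.

Lemma card_incident_le (G : sgraph) (u : G) :
  #|incident u| <= #|[set w | adj u w]|.
Proof.
have sub : incident u \subset [set [set u; w] | w in [set w | adj u w]].
  apply/subsetP => e /incidentP[w uw ->].
  by apply: imset_f; rewrite inE.
exact: leq_trans (subset_leq_card sub) (leq_imset_card _ _).
Qed.

Lemma card_star (G : sgraph) (u : G) (N : {set G}) :
  {in N, forall w, adj u w} -> #|[set [set u; w] | w in N]| = #|N|.
Proof.
move=> Nu; apply: card_in_imset => x y xN yN /setP/(_ x).
rewrite !inE eqxx orbT => /esym/orP[]/eqP // xu.
by have := Nu _ xN; rewrite xu adj_irrefl.
Qed.

(** * Colors along a greedy walk *)

(** For [e] of least color in [A], the colors from [c f] up to [c e - 1] all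
    occur at [v], by the interval condition, on edges outside [A]. *)
Lemma small_color_in_incident (G : sgraph) (c : {set G} -> nat) (v : G)
    (A : {set {set G}}) (f : {set G}) :
    nat_interval (fun i => exists2 e, e \in incident v & c e = i) ->
    A \subset incident v -> A != set0 -> f \in incident v ->
  exists2 e, e \in A & c e + #|A| <= c f + #|incident v|.
Proof.
move=> Iv sAv /set0Pn[e0 e0A] fv.
have [e eA emin] := arg_minnP c e0A; exists e => //.
have ev : e \in incident v by apply: (subsetP sAv).
set B := incident v :\: A.
have cAB : #|incident v| = #|A| + #|B| by rewrite -(cardsID A) (setIidPr sAv).
suff cB : c e - c f <= #|B| by rewrite cAB; lia.
rewrite -(size_iota (c f) (c e - c f)) cardE -(size_map c).
apply: uniq_leq_size (iota_uniq _ _) _ => i.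
rewrite mem_iota => /andP[fi ie].
have lt_ie : i < c e by lia.
have [|||g gv cg] := Iv (c f) (c e) i; [by exists f | by exists e | lia |].
rewrite -cg; apply: map_f; rewrite mem_enum inE gv andbT.
by apply: contraL lt_ie => gA; rewrite -cg -leqNgt emin.
Qed.

(** Here [rho] plays the role of the distance to [v]: the induction on [rho u]
    follows the edge given by [small_color_in_incident], applied to the edges
    towards vertices where [rho] is one less.  The term [j = 0] of the sum
    accounts for the spread of the colors at [v] itself. *)
Lemma color_growth (G : sgraph) (t D : nat) (c : {set G} -> nat) (v : G)
    (rho : G -> nat) :
    interval_coloring t c -> (forall u : G, #|incident u| <= D) ->
    (forall u, rho u = 0 -> u = v) ->
    (forall u, rho u <= #|[set w | adj u w & (rho w).+1 == rho u]|) ->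
  forall u e f, e \in incident u -> f \in incident v ->
    c f < c e + \sum_(j < (rho u).+1) (D - j).
Proof.
move=> [_ _ _ Ic] degD rho0 closer u.
move Dd: (rho u) => d; elim: d u Dd => [|d IHd] u rho_u e f eu fv.
  move: eu; rewrite (rho0 _ rho_u) => ev.
  have f0 : [set f] != set0 by apply/set0Pn; exists f; rewrite set11.
  have sfv : [set f] \subset incident v by rewrite sub1set.
  have [g] := small_color_in_incident (Ic v) sfv f0 ev.
  rewrite inE cards1 => /eqP->; rewrite big_ord1 subn0; have := degD v; lia.
set N := [set w | adj u w & (rho w).+1 == rho u].
have leN : d < #|N| by rewrite -rho_u closer.
have Nadj : {in N, forall w, adj u w} by move=> w; rewrite inE => /andP[].
pose A := [set [set u; w] | w in N].
have cA : #|A| = #|N| by exact: card_star.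
have A0 : A != set0 by rewrite -card_gt0 cA; lia.
have sAu : A \subset incident u.
  by apply/subsetP => g /imsetP[w /Nadj uw ->]; have [] := incident_adj uw.
have [g /imsetP[w wN Dg] le_g] := small_color_in_incident (Ic u) sAu A0 eu.
have rho_w : rho w = d by move: wN; rewrite inE rho_u => /andP[_ /eqP[]].
have gw : g \in incident w by rewrite Dg; have [] := incident_adj (Nadj w wN).
have := IHd w rho_w g f gw fv; rewrite [in X in _ -> X]big_ord_recr /=.
move: le_g (degD u); rewrite cA; move: #|N| leN #|incident u| => nb lt_nb deg.
set S := \sum_(_ < _) _ => le_g le_deg lt_f; lia.
Qed.

(** * Hamming graphs *)

Section Hamming.
Variables (k : nat) (m : 'I_k -> nat).
Let H := hamming_graph m.

Definition hamming_dist (u v : H) : nat := #|[set i | u i != v i]|.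

Definition set_coord (u : H) (i : 'I_k) (x : 'I_(m i)) : H :=
  [ffun j => dfwith u x j].
Arguments set_coord : clear implicits.

Lemma set_coord_eq (u : H) i x : set_coord u i x i = x.
Proof. by rewrite ffunE dfwith_in. Qed.

Lemma set_coord_neq (u : H) i x j : j != i -> set_coord u i x j = u j.
Proof. by move=> ji; rewrite ffunE dfwith_out // eq_sym. Qed.

Lemma hamming_adj_set_coord (u : H) i (x : 'I_(m i)) :
  x != u i -> adj u (set_coord u i x).
Proof.
move=> xu; apply/existsP; exists i; rewrite set_coord_eq /= eq_sym xu /=.
by apply/forallP=> j; apply/implyP=> ji; rewrite set_coord_neq.
Qed.

Lemma hamming_adjP (u w : H) :
  adj u w -> exists i, exists2 x : 'I_(m i), x != u i & w = set_coord u i x.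
Proof.
case/existsP=> i /andP[ui /forallP uw]; exists i, (w i); first by rewrite eq_sym.
apply/ffunP => j; have [->|ji] := eqVneq j i; first by rewrite set_coord_eq.
by rewrite set_coord_neq //; have := uw j; rewrite ji => /eqP.
Qed.

Lemma hamming_degree_le (u : H) : #|incident u| <= \sum_(i < k) (m i - 1).
Proof.
apply: leq_trans (card_incident_le _) _.
have sub : [set w | adj u w] \subset
    \bigcup_(i < k) [set set_coord u i x | x in [set~ u i]].
  apply/subsetP => w; rewrite inE => /hamming_adjP[i [x xu ->]].
  by apply/bigcupP; exists i => //; apply: imset_f; rewrite !inE.
apply: leq_trans (subset_leq_card sub) _.
elim/big_ind2: _ => [|n1 A1 n2 A2 le1 le2|i _]; first by rewrite cards0.
  exact: leq_trans (leq_card_setU _ _) (leq_add le1 le2).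
apply: leq_trans (leq_imset_card _ _) _.
by rewrite cardsC1 card_ord subn1.
Qed.

Lemma hamming_dist_eq0 (u v : H) : hamming_dist u v = 0 -> u = v.
Proof.
move/eqP; rewrite cards_eq0 => /eqP/setP uv.
by apply/ffunP => i; have := uv i; rewrite !inE => /negbFE/eqP.
Qed.

Lemma hamming_dist_le (u v : H) : hamming_dist u v <= k.
Proof. by rewrite -[X in _ <= X]card_ord max_card. Qed.

Lemma hamming_dist_set_coord (u v : H) i :
  u i != v i -> (hamming_dist (set_coord u i (v i)) v).+1 = hamming_dist u v.
Proof.
move=> uvi; rewrite /hamming_dist [RHS](cardsD1 i) inE uvi add1n.
congr _.+1; apply: eq_card => j; rewrite !inE.
have [->|ji] /= := eqVneq j i; first by rewrite set_coord_eq eqxx.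
by rewrite set_coord_neq.
Qed.

(** Distinct coordinates to correct lead to distinct neighbors, since the
    corrected neighbor still differs from [v] everywhere else. *)
Lemma hamming_closer_neighbors (u v : H) :
  hamming_dist u v <=
    #|[set w | adj u w & (hamming_dist w v).+1 == hamming_dist u v]|.
Proof.
have inj : {in [set i | u i != v i] &, injective (fun i => set_coord u i (v i))}.
  move=> i j; rewrite !inE => ui uj eq_ij; apply/eqP/negPn/negP => ij.
  have /eqP[] := ui; have /ffunP/(_ i) := eq_ij.
  by rewrite set_coord_eq set_coord_neq.
rewrite {1}/hamming_dist -(card_in_imset inj).
apply: subset_leq_card; apply/subsetP => _ /imsetP[i + ->].
rewrite !inE => ui; rewrite hamming_adj_set_coord 1?eq_sym //=.
by rewrite hamming_dist_set_coord.
Qed.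

Lemma maxW_hamming_le :
  maxW H <= \sum_(j < k.+1) (\sum_(i < k) (m i - 1) - j).
Proof.
set D := \sum_(i < k) _.
apply/bigmax_leqP => t /asboolP[t_gt0 [c ct]].
have [_ _ used _] := ct.
have [|e eE ce] := used 1; [lia|].
have [|f fE cf] := used t; [lia|].
have [u eu] := edge_incident eE; have [v fv] := edge_incident fE.
have := color_growth ct hamming_degree_le
  (@hamming_dist_eq0^~ v) (hamming_closer_neighbors^~ v) eu fv.
rewrite ce cf add1n ltnS -/D => /leq_trans; apply.
rewrite (big_ord_widen k.+1 (fun j => D - j)) ?ltnS ?hamming_dist_le //.
by rewrite big_mkcond; apply: leq_sum => j _; case: ifP.
Qed.

End Hamming.

Local Open Scope ring_scope.

Lemma sum_subn_natr (R : numFieldType) (D k : nat) : (k <= D)%N ->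
  (\sum_(j < k.+1) (D - j))%:R = (k%:R + 1) * (D%:R - k%:R / 2) :> R.
Proof.
elim: k => [|k IHk] kD; first by rewrite big_ord1 subn0; field.
rewrite big_ord_recr /= natrD IHk ?(ltnW kD) // natrB // -natr1.
by field.
Qed.

Unset Implicit Arguments.

Theorem theorem5p4 (k : nat) (n : 'I_k -> nat) (k_gt0 : (0 < k)%N)
    (n_gt0 : forall i, (0 < n i)%N) :
  (maxW (hamming_graph (fun i => (2 * n i)%N)))%:R
    <= 1 / 2 * (k%:R + 1) * \sum_(i < k) (4 * (n i)%:R - 3) :> rat.
Proof.
set D := (\sum_(i < k) (2 * n i - 1))%N.
have kD : (k <= D)%N.
  rewrite -[X in (X <= _)%N]card_ord -sum1_card; apply: leq_sum => i _.
  by have := n_gt0 i; lia.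
have DE : D%:R = \sum_(i < k) (2 * (n i)%:R - 1) :> rat.
  rewrite natr_sum; apply: eq_bigr => i _.
  by rewrite natrB ?natrM //; have := n_gt0 i; lia.
have -> : \sum_(i < k) (4 * (n i)%:R - 3) = 2 * D%:R - k%:R :> rat.
  rewrite DE mulr_sumr -[X in _ = _ - X%:R]card_ord -sumr_const -sumrB.
  by apply: eq_bigr => i _; ring.
have -> : 1 / 2 * (k%:R + 1) * (2 * D%:R - k%:R) =
    (\sum_(j < k.+1) (D - j))%:R :> rat.
  by rewrite sum_subn_natr //; field.
by rewrite ler_nat; exact: maxW_hamming_le.
Qed.
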